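(* Let $\mathcal T\subset\mathbb R$ be a Borel set. Suppose that the process $\Phi(t)\in\mathcal G^*$ is Skorohod-integrable over $\mathcal T$, and that $s\mapsto D_t\Phi(s)$ is Skorohod-integrable over $\mathcal T$ for almost all $t\in\mathcal T$. Then, for almost all $t\in\mathcal T$, $$D_t\left(\int_{\mathcal T}\Phi(s)\,\delta B(s)\right)=\Phi(t)+\int_{\mathcal T}D_t\Phi(s)\,\delta B(s).$$
   Context: Let $\mu$ be the Gaussian white noise measure on the space of tempered distributions $\mathcal S'(\mathbb R)$, i.e. $\int e^{i\langle x,\xi\rangle}\,d\mu(x)=e^{-\frac12|\xi|^2_{L^2(\mathbb R)}}$ for $\xi\in\mathcal S(\mathbb R)$, and let $(L^2)=L^2(\mathcal S'(\mathbb R),\mu)$. Every $\phi\in(L^2)$ has a unique chaos expansion $\phi=\sum_{n\ge0}I_n(\phi^{(n)})$ with symmetric $\phi^{(n)}\in L^2(\mathbb R^n)$, where $I_n$ is the $n$-fold iterated Wiener integral. For $\lambda\in\mathbb R$ put $\|\phi\|_\lambda^2=\sum_{n\ge0}n!\,e^{2\lambda n}|\phi^{(n)}|^2_{L^2(\mathbb R^n)}$, and let $\mathcal G_\lambda$ be the space of (for $\lambda<0$: formal) chaos series $\sum_nI_n(\phi^{(n)})$ with symmetric kernels $\phi^{(n)}\in L^2(\mathbb R^n)$ and $\|\phi\|_\lambda<\infty$. $\mathcal G=\bigcap_{\lambda>0}\mathcal G_\lambda$ and its dual is $\mathcal G^*=\bigcup_{\lambda>0}\mathcal G_{-\lambda}$.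 For $\Phi=\sum_{n\ge0}I_n(\Phi^{(n)})\in\mathcal G^*$ the stochastic derivative at $t$ is $D_t\Phi=\sum_{n\ge1}n\,I_{n-1}(\Phi^{(n)}(\cdot,t))$. For a $\mathcal G^*$-valued process $\Phi(t)=\sum_{n\ge0}I_n(\Phi^{(n)}(\cdot,t))$ the Skorohod integral is $\int_{\mathbb R}\Phi(t)\,\delta B(t)=\sum_{n\ge0}I_{n+1}(\widehat\Phi^{(n)})$, where $\widehat\Phi^{(n)}$ is the symmetrization of $\Phi^{(n)}$ in all $n+1$ variables; $\Phi$ is Skorohod-integrable if $\sum_n(n+1)!\,e^{-2(n+1)\lambda}|\widehat\Phi^{(n)}|^2_{L^2(\mathbb R^{n+1})}<\infty$ for some $\lambda>0$. Integrals over $\mathcal T$ are integrals of $\mathbf 1_{\mathcal T}\Phi$. *)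

(* Defs.v *)
From HB Require Import structures.
From mathcomp Require Import all_boot all_order all_algebra all_fingroup.
From mathcomp Require Import all_classical all_reals all_analysis.

Set Implicit Arguments.
Unset Strict Implicit.
Unset Printing Implicit Defensive.

Import Order.TTheory GRing.Theory Num.Theory.
Import numFieldNormedType.Exports.

Local Open Scope classical_set_scope.
Local Open Scope ring_scope.

Notation Rn R n := (n.-tuple (measurableTypeR R)).

Section last_coordinate.
Context {R : realType} {n : nat}.
Implicit Types (x : Rn R n) (t : measurableTypeR R) (y : Rn R n.+1).

Definition snoc x t : Rn R n.+1 := [tuple of rcons x t].

Definition but_last y : Rn R n :=
  [tuple tnth y (widen_ord (leqnSn n) i) | i < n].

Definition last_coord y : measurableTypeR R := tnth y ord_max.

Lemma but_last_snoc x t : but_last (snoc x t) = x.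
Proof.
apply: eq_from_tnth => i; rewrite tnth_mktuple !(tnth_nth 0) /=.
by rewrite nth_rcons size_tuple ltn_ord.
Qed.

Lemma last_coord_snoc x t : last_coord (snoc x t) = t.
Proof.
by rewrite /last_coord (tnth_nth 0) /= nth_rcons size_tuple ltnn eqxx.
Qed.

Lemma measurable_snoc : measurable_fun setT (fun p => snoc p.1 p.2).
Proof.
apply/measurable_fun_tnthP => i.
have [ilt|ige] := ltnP i n.
  rewrite (_ : _ \o _ = (fun x => tnth x (Ordinal ilt)) \o fst); last first.
    apply/funext => -[x t] /=.
    by rewrite !(tnth_nth 0) /= nth_rcons size_tuple ilt.
  by apply: measurableT_comp => //; exact: measurable_tnth.
rewrite (_ : _ \o _ = snd) //; apply/funext => -[x t] /=.
rewrite (tnth_nth 0) /= nth_rcons size_tuple ltnNge ige /=.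
by rewrite eqn_leq ige -ltnS ltn_ord.
Qed.

Lemma measurable_but_last : measurable_fun setT but_last.
Proof.
apply/measurable_fun_tnthP => i.
rewrite (_ : _ \o _ = fun y => tnth y (widen_ord (leqnSn n) i)).
  exact: measurable_tnth.
by apply/funext => y /=; rewrite tnth_mktuple.
Qed.

Lemma measurable_last_coord : measurable_fun setT last_coord.
Proof. exact: measurable_tnth. Qed.

End last_coordinate.

Section lebesgue_step.
Context {R : realType} (n : nat).
Variable m : {sigma_finite_measure set (Rn R n) -> \bar R}.

Definition lebesgue_step : set (Rn R n.+1) -> \bar R :=
  pushforward (m \x @lebesgue_measure R)%E (fun p => snoc p.1 p.2).

Let lebesgue_step0 : lebesgue_step set0 = 0%E.
Proof. by rewrite /lebesgue_step /pushforward preimage_set0 measure0. Qed.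

Let lebesgue_step_ge0 A : (0 <= lebesgue_step A)%E.
Proof. by rewrite /lebesgue_step /pushforward measure_ge0. Qed.

Let lebesgue_step_sigma_additive : semi_sigma_additive lebesgue_step.
Proof.
move=> F mF tF mUF; rewrite /lebesgue_step /pushforward preimage_bigcup.
apply: measure_semi_sigma_additive.
- by move=> k; rewrite -[X in measurable X]setTI; exact: measurable_snoc.
- apply/trivIsetP => /= i j _ _ ij; rewrite -preimage_setI.
  by move/trivIsetP : tF => /(_ _ _ _ _ ij) ->//; rewrite preimage_set0.
- rewrite -preimage_bigcup -[X in measurable X]setTI.
  exact: measurable_snoc.
Qed.

HB.instance Definition _ := isMeasure.Build _ _ _ lebesgue_step
  lebesgue_step0 lebesgue_step_ge0 lebesgue_step_sigma_additive.

Let lebesgue_step_sigma_finite : sigma_finite setT lebesgue_step.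
Proof.
have /sigma_finiteP[F [TF ndF Foo]] := sigma_finiteT m.
have /sigma_finiteP[G [TG ndG Goo]] := sigma_finiteT (@lebesgue_measure R).
exists (fun k => but_last @^-1` F k `&` last_coord @^-1` G k).
  apply/esym; rewrite -subTset => y _.
  have [i _ Fi] : (\bigcup_i F i) (but_last y) by rewrite -TF.
  have [j _ Gj] : (\bigcup_i G i) (last_coord y) by rewrite -TG.
  exists (maxn i j) => //; split => /=.
    by move: Fi; exact/subsetPset/ndF/leq_maxl.
  by move: Gj; exact/subsetPset/ndG/leq_maxr.
move=> k; have [mF Fk] := Foo k; have [mG Gk] := Goo k; split.
  apply: measurableI; rewrite -[X in measurable X]setTI.
    exact: measurable_but_last.
  exact: measurable_last_coord.
rewrite /lebesgue_step /pushforward.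
rewrite (_ : _ @^-1` _ = F k `*` G k).
  by rewrite product_measure1E// lte_mul_pinfty// ge0_fin_numE.
by apply/seteqP; split=> -[x t] /=; rewrite but_last_snoc last_coord_snoc.
Qed.

HB.instance Definition _ := Measure_isSigmaFinite.Build _ _ _ lebesgue_step
  lebesgue_step_sigma_finite.

End lebesgue_step.

(* Lebesgue measure on R^n: the n-fold product of lebesgue_measure. *)
Fixpoint lebesgue_Rn {R : realType} n :
    {sigma_finite_measure set (Rn R n) -> \bar R} :=
  match n with
  | 0%N => @dirac _ _ ([tuple] : Rn R 0) R
  | k.+1 => lebesgue_step (lebesgue_Rn k)
  end.

Section chaos.
Context {R : realType}.

Definition perm_coord n (s : 'S_n) (x : Rn R n) : Rn R n :=
  [tuple tnth x (s i) | i < n].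

(* Kernels are representatives of classes in L^2(R^n), so their symmetry is
   an almost everywhere property. *)
Definition ae_symmetric n (f : Rn R n -> R) :=
  forall s : 'S_n, {ae lebesgue_Rn n, forall x, f (perm_coord s x) = f x}.

Definition symmetrization n (f : Rn R n -> R) : Rn R n -> R :=
  fun x => (n`!%:R)^-1 * \sum_(s : 'S_n) f (perm_coord s x).

Definition L2norm_sq n (f : Rn R n -> R) : \bar R :=
  ('N[lebesgue_Rn n]_(2%:E) [EFin \o f] ^+ 2)%E.

(* [phi : chaos] stands for the formal chaos series \sum_n I_n(phi n). Since
   the kernels are determined by the series, operations on series are given
   by their action on kernels, and I_n does not appear explicitly. *)
Definition chaos := forall n, Rn R n -> R.

Definition chaos_add (phi psi : chaos) : chaos :=
  fun n x => phi n x + psi n x.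

Definition chaos_norm_sq (lambda : R) (phi : chaos) : \bar R :=
  (\sum_(0 <= n <oo)
    (n`!%:R * expR (2 * lambda * n%:R))%:E * L2norm_sq (phi n))%E.

Definition in_G_ (lambda : R) (phi : chaos) :=
  (forall n, phi n \in Lfun (lebesgue_Rn n) 2%:E /\ ae_symmetric (phi n)) /\
  (chaos_norm_sq lambda phi < +oo)%E.

Definition in_Gstar (phi : chaos) :=
  exists2 lambda : R, 0 < lambda & in_G_ (- lambda) phi.

(* Equality of elements of G^*: equality of the kernels in L^2(R^n). *)
Definition eq_Gstar (phi psi : chaos) :=
  [/\ in_Gstar phi, in_Gstar psi
    & forall n, {ae lebesgue_Rn n, forall x, phi n x = psi n x}].

Definition stoch_deriv (t : R) (phi : chaos) : chaos :=
  fun n x => n.+1%:R * phi n.+1 (snoc x t).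

Definition joint_kernel (Phi : R -> chaos) n : Rn R n.+1 -> R :=
  fun y => Phi (last_coord y) n (but_last y).
Arguments joint_kernel Phi n _ : clear implicits.

(* The kernels of a process are jointly measurable; as they are themselves only
   meaningful almost everywhere, so is membership of [Phi t] in G^*. *)
Definition Gstar_process (Phi : R -> chaos) :=
  (forall n, measurable_fun setT (joint_kernel Phi n)) /\
  {ae @lebesgue_measure R, forall t, in_Gstar (Phi t)}.

Definition restrict_process (T : set R) (Phi : R -> chaos) : R -> chaos :=
  fun t n x => \1_T t * Phi t n x.

Definition skorohod (Phi : R -> chaos) : chaos := fun n =>
  match n with
  | 0%N => fun=> 0
  | k.+1 => symmetrization (joint_kernel Phi k)
  end.

Definition skorohod_integrable (Phi : R -> chaos) :=
  Gstar_process Phi /\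
  exists2 lambda : R, 0 < lambda &
    (\sum_(0 <= n <oo)
      ((n.+1)`!%:R * expR (- (2 * n.+1%:R * lambda)))%:E *
        L2norm_sq (symmetrization (joint_kernel Phi n)) < +oo)%E.

Definition skorohod_on (T : set R) (Phi : R -> chaos) : chaos :=
  skorohod (restrict_process T Phi).

Definition skorohod_integrable_on (T : set R) (Phi : R -> chaos) :=
  skorohod_integrable (restrict_process T Phi).

End chaos.

Arguments chaos : clear implicits.
Arguments joint_kernel {R} Phi n _.

(* Main.v *)
Require Import Defs.
From mathcomp Require Import all_boot all_order all_algebra all_fingroup.
From mathcomp Require Import all_classical all_reals all_analysis.
From mathcomp Require Import measurable_realfun.
From mathcomp Require Import ring.

Set Implicit Arguments.
Unset Strict Implicit.
Unset Printing Implicit Defensive.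

Import Order.TTheory GRing.Theory Num.Theory.
Import numFieldNormedType.Exports.

Local Open Scope classical_set_scope.
Local Open Scope ring_scope.

(** The kernel of order [n] of the Skorohod integral of [Phi] over [T] sits in
    order [n.+1]: it is the symmetrization of
    [f (x, t) = \1_T t * Phi t n x]. Since [f] is already symmetric in its first
    [n] arguments, the value of [f] at a permutation of the coordinates of
    [y = (x_0, .., x_n)] only depends on which coordinate [x_j] is put last;
    call it [f_j y]. Each [j] is hit by [n`!] of the [n.+1`!] permutations, so
    that [n.+1] times the symmetrization of [f] is [\sum_(j <= n) f_j]
    ([mulr_symmetrization]). Evaluated at [x_n = t], the left-hand side is the
    kernel of order [n] of [D_t] of the Skorohod integral. On the right, the
    term [j = n] is [f (x, t)], which is [Phi t n x] for [t] in [T], and the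
    terms [j < n] make up the kernel of the Skorohod integral of [D_t Phi], by
    the same count over the permutations of [n] letters
    ([skorohod_on_stoch_derivE]).

    The kernels are symmetric only almost everywhere, and for each [t]
    separately. To use this symmetry after an arbitrary permutation of the
    [n.+1] variables, one passes from almost every slice to almost every point
    of R^n.+1 and back by Tonelli ([ae_snoc], [ae_of_snoc]), and uses that null
    sets are invariant under permutations of the coordinates
    ([ae_perm_coord]).

    It remains to see that both sides lie in G^* for almost every [t]. By
    Tonelli, the integral over [t] of the squared norm of [D_t] of the Skorohod
    integral is a weighted sum of the squared norms of the symmetrized kernels.
    The derivative brings in an additional factor [n.+1], which is absorbed by
    passing from [lambda] to [lambda + 1]; the sum is then finite by
    Skorohod-integrability ([in_Gstar_stoch_deriv_skorohod]). The other side has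
    almost everywhere the same measurable kernels, hence also lies in G^*. *)

(** * Permutations of coordinates *)

Lemma lift_max_widen n (i : 'I_n) : lift ord_max i = widen_ord (leqnSn n) i.
Proof. by apply: val_inj; exact: lift_max. Qed.

Lemma tnth_snoc_lift (R : realType) n (x : Rn R n) (t : R) i :
  tnth (snoc x t) (lift ord_max i) = tnth x i.
Proof. by rewrite lift_max_widen -{2}(but_last_snoc x t) tnth_mktuple. Qed.

Lemma tnth_snoc_max (R : realType) n (x : Rn R n) (t : R) :
  tnth (snoc x t) ord_max = t.
Proof. exact: last_coord_snoc. Qed.

Definition tnth_snoc := (tnth_snoc_lift, tnth_snoc_max).

Lemma eq_snoc (R : realType) n (x : Rn R n) (t : R) (y : Rn R n.+1) :
  (forall i, tnth y (lift ord_max i) = tnth x i) -> tnth y ord_max = t ->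
  snoc x t = y.
Proof.
move=> yx yt; apply: eq_from_tnth => j.
by case: (unliftP ord_max j) => [i|] ->; rewrite tnth_snoc.
Qed.

Lemma perm_coord1 (R : realType) n (x : Rn R n) : perm_coord 1%g x = x.
Proof. by apply: eq_from_tnth => i; rewrite tnth_mktuple perm1. Qed.

Lemma perm_coordM (R : realType) n (s r : 'S_n) (x : Rn R n) :
  perm_coord s (perm_coord r x) = perm_coord (s * r)%g x.
Proof. by apply: eq_from_tnth => i; rewrite !tnth_mktuple permM. Qed.

Lemma perm_coord_snoc (R : realType) n (s : 'S_n) (x : Rn R n) (t : R) :
  perm_coord (lift_perm ord_max ord_max s) (snoc x t) = snoc (perm_coord s x) t.
Proof.
apply/esym/eq_snoc => [i|]; rewrite tnth_mktuple.
  by rewrite lift_perm_lift tnth_snoc tnth_mktuple.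
by rewrite lift_perm_id tnth_snoc.
Qed.

Lemma lift_perm_surj n (q : 'S_n.+1) :
  q ord_max = ord_max -> exists s, q = lift_perm ord_max ord_max s.
Proof.
move=> qmax.
have liftq i : exists j, q (lift ord_max i) = lift ord_max j.
  case: (unliftP ord_max (q (lift ord_max i))) => [j ->|]; first by exists j.
  rewrite -[RHS]qmax => /perm_inj /eqP.
  by rewrite eq_sym (negPf (neq_lift _ _)).
have [f qf] := choice liftq.
have f_inj : injective f.
  move=> i j fij; apply: (lift_inj (h := ord_max)).
  by apply: (perm_inj (s := q)); rewrite !qf fij.
exists (perm f_inj); apply/permP => j.
case: (unliftP ord_max j) => [i|] ->; last by rewrite lift_perm_id.
by rewrite lift_perm_lift permE.
Qed.

Lemma measurable_perm_coord (R : realType) n (s : 'S_n) :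
  measurable_fun setT (@perm_coord R n s).
Proof.
apply/measurable_fun_tnthP => i.
rewrite (_ : _ \o _ = fun x => tnth x (s i)); first exact: measurable_tnth.
by apply/funext => x /=; rewrite tnth_mktuple.
Qed.

Lemma measurable_snocl (R : realType) n (t : R) :
  measurable_fun setT (fun x : Rn R n => snoc x t).
Proof.
exact: (measurableT_comp measurable_snoc (measurable_pair2 _)).
Qed.

(** Each value of [s i] is taken by the same number [n`!] of permutations: the
    sum does not depend on [i], and summing it over [i] as well makes every
    permutation run through all indices. *)
Lemma sum_perm_at (F : numFieldType) n (c : 'I_n.+1 -> F) (i : 'I_n.+1) :
  \sum_(s : 'S_n.+1) c (s i) = n`!%:R * \sum_j c j.
Proof.
have indep j : \sum_(s : 'S_n.+1) c (s j) = \sum_(s : 'S_n.+1) c (s i).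
  rewrite (reindex_inj (mulgI (tperm i j))); apply: eq_bigr => s _.
  by rewrite permM tpermR.
have n1 : n.+1%:R != 0 :> F by rewrite pnatr_eq0.
apply: (mulfI n1); rewrite mulrA -natrM -factS.
transitivity (\sum_j \sum_(s : 'S_n.+1) c (s j)).
  rewrite (eq_bigr _ (fun j _ => indep j)) sumr_const card_ord.
  by rewrite mulr_natl.
rewrite exchange_big /= (eq_bigr (fun=> \sum_j c j)); last first.
  by move=> s _; rewrite [RHS](reindex_inj (@perm_inj _ s)).
by rewrite sumr_const card_Sn mulr_natl.
Qed.

(** * Lebesgue measure on R^n *)

Lemma integral_snoc (R : realType) n (f : Rn R n.+1 -> \bar R) :
  measurable_fun setT f -> (forall y, (0 <= f y)%E) ->
  (\int[lebesgue_Rn n.+1]_y f y =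
   \int[lebesgue_measure]_t \int[lebesgue_Rn n]_x f (snoc x t))%E.
Proof.
move=> mf f0.
rewrite [LHS](ge0_integral_pushforward measurable_snoc)//.
rewrite (fubini_tonelli2 (fun p => f (snoc p.1 p.2)))//.
exact: measurableT_comp measurable_snoc.
Qed.

Lemma measurable_integral_snoc (R : realType) n (f : Rn R n.+1 -> \bar R) :
  measurable_fun setT f -> (forall y, (0 <= f y)%E) ->
  measurable_fun setT
    (fun t : measurableTypeR R => \int[lebesgue_Rn n]_x f (snoc x t))%E.
Proof.
move=> mf f0.
apply: (measurable_fun_fubini_tonelli_G (fun p => f (snoc p.1 p.2))) => //.
exact: measurableT_comp measurable_snoc.
Qed.

Lemma measurable_slice (R : realType) n (A : set (Rn R n.+1)) (t : R) :
  measurable A -> measurable ((fun x => snoc x t) @^-1` A).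
Proof.
by move=> mA; rewrite -[X in measurable X]setTI; exact: measurable_snocl.
Qed.

Lemma lebesgue_Rn_slices (R : realType) n (A : set (Rn R n.+1)) :
  measurable A ->
  lebesgue_Rn n.+1 A =
  (\int[lebesgue_measure]_t lebesgue_Rn n ((fun x => snoc x t) @^-1` A))%E.
Proof.
move=> mA; rewrite -[in LHS](setIT A) -integral_indic//.
rewrite integral_snoc//; last first.
  exact/measurable_EFinP.
apply: eq_integral => t _.
rewrite -[X in lebesgue_Rn n X]setIT -integral_indic//.
exact: measurable_slice.
Qed.

Lemma measurable_lebesgue_Rn_slice (R : realType) n (A : set (Rn R n.+1)) :
  measurable A ->
  measurable_fun setT (fun t : measurableTypeR R =>
    lebesgue_Rn n ((fun x => snoc x t) @^-1` A)).
Proof.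
move=> mA; rewrite (_ : (fun _ => _) = fun t : measurableTypeR R =>
    (\int[lebesgue_Rn n]_x (\1_A (snoc x t))%:E)%E).
  apply: (@measurable_integral_snoc _ _ (fun y => (\1_A y)%:E)) => [|y].
    exact/measurable_EFinP.
  by rewrite lee_fin.
apply/funext => t; rewrite -[X in lebesgue_Rn n X]setIT -integral_indic//.
exact: measurable_slice.
Qed.

Lemma lebesgue_Rn_null_slices (R : realType) n (A : set (Rn R n.+1)) :
  measurable A ->
  lebesgue_Rn n.+1 A = 0%E <->
  {ae @lebesgue_measure R, forall t,
    lebesgue_Rn n ((fun x => snoc x t) @^-1` A) = 0%E}.
Proof.
move=> mA; rewrite lebesgue_Rn_slices//.
have mAt := measurable_lebesgue_Rn_slice mA.
have := ae_eq_integral_abs lebesgue_measure measurableT mAt.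
under eq_integral do rewrite gee0_abs//.
by move=> ->; split; apply: filterS => t; [exact|].
Qed.

Lemma ae_snoc (R : realType) n (P : Rn R n.+1 -> Prop) :
  {ae lebesgue_Rn n.+1, forall y, P y} ->
  {ae @lebesgue_measure R, forall t,
    {ae lebesgue_Rn n, forall x, P (snoc x t)}}.
Proof.
move=> [N [mN N0 PN]]; move/(lebesgue_Rn_null_slices mN) : N0.
apply: filterS => t Nt; exists ((fun x => snoc x t) @^-1` N); split => //.
  exact: measurable_slice.
by move=> x nP; exact: PN.
Qed.

(** The measurability of [P] is essential: a set can have null slices without
    being contained in a measurable null set. *)
Lemma ae_of_snoc (R : realType) n (P : set (Rn R n.+1)) :
  measurable P ->
  {ae @lebesgue_measure R, forall t,
    {ae lebesgue_Rn n, forall x, P (snoc x t)}} ->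
  {ae lebesgue_Rn n.+1, forall y, P y}.
Proof.
move=> mP aeP; have mC : measurable (~` P) by exact: measurableC.
exists (~` P); split => //; apply/(lebesgue_Rn_null_slices mC).
apply: filterS aeP => t [N [mN N0 PN]].
exact: (subset_measure0 (measurable_slice t mC) mN PN N0).
Qed.

Definition box (R : realType) n (A : 'I_n -> set (measurableTypeR R)) :
    set (Rn R n) :=
  [set x | forall i, A i (tnth x i)].

Definition measurable_boxes (R : realType) n : set (set (Rn R n)) :=
  [set B | exists2 A : 'I_n -> set (measurableTypeR R),
     forall i, measurable (A i) & B = box A].

Lemma measurable_box (R : realType) n (A : 'I_n -> set (measurableTypeR R)) :
  (forall i, measurable (A i)) -> measurable (box A).
Proof.
move=> mA; rewrite (_ : box A =
    \big[setI/setT]_(i < n) ((fun x => tnth x i) @^-1` A i)).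
  apply: bigsetI_measurable => i _; rewrite -[X in measurable X]setTI.
  exact: measurable_tnth.
apply/seteqP; split => x.
  by move=> Ax; rewrite -bigcap_seq => i _; exact: Ax.
by rewrite -bigcap_seq => Ax i; apply: Ax; rewrite /= mem_index_enum.
Qed.

Lemma measurable_RnE (R : realType) n :
  @measurable _ (Rn R n) = <<s @measurable_boxes R n >>.
Proof.
apply/seteqP; split.
  apply: smallest_sub; first exact: smallest_sigma_algebra.
  rewrite -bigcup_seq => B [i _ [A mA <-]].
  apply: sub_sigma_algebra.
  exists (fun j => if j == i then A else setT) => [j|]; first by case: ifP.
  rewrite setTI; apply/seteqP; split => x /=.
    by move=> Ax j; case: ifPn => // /eqP ->.
  by move=> /(_ i); rewrite eqxx.
apply: smallest_sub; first exact: sigma_algebra_measurable.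
by move=> B [A mA ->]; exact: measurable_box.
Qed.

Lemma lebesgue_Rn_box (R : realType) n (A : 'I_n -> set (measurableTypeR R)) :
  (forall i, measurable (A i)) ->
  lebesgue_Rn n (box A) = (\prod_(i < n) lebesgue_measure (A i))%E.
Proof.
elim: n A => [|n IHn] A mA.
  by rewrite big_ord0 /= diracE mem_set// => -[].
rewrite big_ord_recr /= /lebesgue_step /pushforward.
rewrite (_ : _ @^-1` _ =
    box (fun i => A (widen_ord (leqnSn n) i)) `*` A ord_max).
  rewrite product_measure1E//.
    by congr (_ * _)%E; exact: IHn.
  exact: (@measurable_box _ _ (fun i => A (widen_ord (leqnSn n) i))).
apply/seteqP; split => -[x t] /=.
  move=> Axt; split => [i|]; last by have := Axt ord_max; rewrite tnth_snoc.
  by have := Axt (lift ord_max i); rewrite tnth_snoc lift_max_widen.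
move=> [Ax At] j; case: (unliftP ord_max j) => [i|] ->; rewrite tnth_snoc//.
by rewrite lift_max_widen; exact: Ax.
Qed.

(** Boxes generate the measurable sets and are stable under intersection, and a
    permutation of the coordinates permutes the sides of a box, so that it
    preserves the product of their lengths. *)
Lemma lebesgue_Rn_perm (R : realType) n (s : 'S_n) (A : set (Rn R n)) :
  measurable A -> lebesgue_Rn n (perm_coord s @^-1` A) = lebesgue_Rn n A.
Proof.
move=> mA; pose K k : set (measurableTypeR R) := `[- k%:R, k%:R]%classic.
have mK k : measurable (K k) by exact: measurable_itv.
apply/esym; apply: (measure_unique (@measurable_boxes R n)
  (fun k => box (fun=> K k)) _ _ _ _ (lebesgue_Rn n)
  (pushforward (lebesgue_Rn n) (perm_coord s))) mA.
- exact: measurable_RnE.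
- move=> _ _ [A1 mA1 ->] [A2 mA2 ->].
  exists (fun i => A1 i `&` A2 i) => [i|]; first exact: measurableI.
  apply/seteqP; split => x /=; first by move=> [x1 x2] i.
  by move=> x12; split => i; have [] := x12 i.
- by move=> k; exists (fun=> K k).
- apply/seteqP; split => // x _.
  (* The sum of the absolute values bounds every coordinate. *)
  exists (Num.truncn (\sum_i `|tnth x i|)).+1 => // i.
  rewrite /K /= in_itv /= -ler_norml; apply: ltW.
  apply: le_lt_trans (truncnS_gt _).
  by rewrite (bigD1 i) //= lerDl sumr_ge0.
- exact: measurable_perm_coord.
- move=> ms _ [B mB ->].
  have permB : perm_coord s @^-1` box B = box (fun i => B ((s^-1)%g i)).
    apply/seteqP; split => x /= Bx i.
      by have := Bx ((s^-1)%g i); rewrite tnth_mktuple permKV.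
    by have := Bx (s i); rewrite tnth_mktuple permK.
  transitivity (lebesgue_Rn n (box (fun i => B ((s^-1)%g i)))).
    rewrite [RHS]lebesgue_Rn_box// [RHS](reindex_inj (@perm_inj _ s)).
    by under [RHS]eq_bigr do rewrite permK; exact: lebesgue_Rn_box.
  by rewrite -permB.
- move=> k; suff : (\prod_(i < n) lebesgue_measure (K k) < +oo)%E.
    by rewrite -(lebesgue_Rn_box (fun=> mK k)).
  rewrite ltey_eq; apply/orP; left.
  elim/big_ind: _ => // [x y|i _]; first exact: fin_numM.
  by rewrite lebesgue_measure_itv /=; case: ifP.
Qed.

Lemma ae_perm_coord (R : realType) n (s : 'S_n) (P : Rn R n -> Prop) :
  {ae lebesgue_Rn n, forall x, P x} ->
  {ae lebesgue_Rn n, forall x, P (perm_coord s x)}.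
Proof.
move=> [N [mN N0 PN]]; exists (perm_coord s @^-1` N); split.
- by rewrite -[X in measurable X]setTI; exact: measurable_perm_coord.
- by rewrite lebesgue_Rn_perm.
- by move=> x nP; exact: PN.
Qed.

(** * Square-integrable kernels *)

Lemma L2norm_sqE (R : realType) n (f : Rn R n -> R) :
  L2norm_sq f = (\int[lebesgue_Rn n]_x ((f x) ^+ 2)%:E)%E.
Proof.
rewrite /L2norm_sq; transitivity ('N[lebesgue_Rn n]_2%:E[EFin \o f] `^ 2)%E.
  have := Lnorm_ge0 (lebesgue_Rn n) 2%:E (EFin \o f).
  case: ('N[_]_2%:E[_])%E => [r r0||//]; last by rewrite poweRyr// mulyy.
  by rewrite poweR_EFin powR_mulrn// EFin_expe.
rewrite poweR_Lnorm//.
apply: eq_integral => x _ /=.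
by rewrite powR_mulrn// -normrX ger0_norm// sqr_ge0.
Qed.

Lemma L2norm_sq_ge0 (R : realType) n (f : Rn R n -> R) : (0 <= L2norm_sq f)%E.
Proof.
by rewrite L2norm_sqE; apply: integral_ge0 => x _; rewrite lee_fin sqr_ge0.
Qed.

Lemma measurable_sqr_EFin (R : realType) n (f : Rn R n -> R) :
  measurable_fun setT f -> measurable_fun setT (fun x => ((f x) ^+ 2)%:E).
Proof. by move=> mf; apply/measurable_EFinP; exact: measurable_funX. Qed.

Lemma L2norm_sqZ (R : realType) n (a : R) (f : Rn R n -> R) :
  measurable_fun setT f ->
  L2norm_sq (fun x => a * f x) = ((a ^+ 2)%:E * L2norm_sq f)%E.
Proof.
move=> mf; rewrite !L2norm_sqE -ge0_integralZl//.
- by apply: eq_integral => x _; rewrite exprMn EFinM.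
- exact: measurable_sqr_EFin.
- by move=> x _; rewrite lee_fin sqr_ge0.
- by rewrite lee_fin sqr_ge0.
Qed.

Lemma ae_eq_L2norm_sq (R : realType) n (f g : Rn R n -> R) :
  measurable_fun setT f -> measurable_fun setT g ->
  {ae lebesgue_Rn n, forall x, f x = g x} -> L2norm_sq f = L2norm_sq g.
Proof.
move=> mf mg fg; rewrite !L2norm_sqE; apply: ge0_ae_eq_integral => //.
- exact: measurable_sqr_EFin.
- exact: measurable_sqr_EFin.
- by move=> x _; rewrite lee_fin sqr_ge0.
- by move=> x _; rewrite lee_fin sqr_ge0.
- by apply: filterS fg => x + _ => ->.
Qed.

Lemma Lfun_L2norm_sq (R : realType) n (f : Rn R n -> R) :
  measurable_fun setT f -> (L2norm_sq f < +oo)%E ->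
  f \in Lfun (lebesgue_Rn n) 2%:E.
Proof.
move=> mf foo; rewrite inE; apply/andP; split; rewrite inE//=.
move: foo; rewrite /finite_norm /L2norm_sq.
have := Lnorm_ge0 (lebesgue_Rn n) 2%:E (EFin \o f).
case: ('N[_]_2%:E[_])%E => [r _ _|_|//]; first exact: ltry.
by rewrite expe2 mulyy.
Qed.

Lemma L2norm_sq_snoc (R : realType) n (f : Rn R n.+1 -> R) :
  measurable_fun setT f ->
  (L2norm_sq f =
   \int[lebesgue_measure]_t L2norm_sq (fun x => f (snoc x t)))%E.
Proof.
move=> mf; rewrite L2norm_sqE integral_snoc.
- by apply: eq_integral => t _; rewrite L2norm_sqE.
- exact: measurable_sqr_EFin.
- by move=> y; rewrite lee_fin sqr_ge0.
Qed.

Lemma measurable_L2norm_sq_snoc (R : realType) n (f : Rn R n.+1 -> R) :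
  measurable_fun setT f ->
  measurable_fun setT
    (fun t : measurableTypeR R => L2norm_sq (fun x => f (snoc x t))).
Proof.
move=> mf; rewrite (_ : (fun _ => _) = fun t : measurableTypeR R =>
    (\int[lebesgue_Rn n]_x ((f (snoc x t)) ^+ 2)%:E)%E).
  apply: (@measurable_integral_snoc _ _ (fun y => ((f y) ^+ 2)%:E)) => [|y].
    exact: measurable_sqr_EFin.
  by rewrite lee_fin sqr_ge0.
by apply/funext => t; rewrite L2norm_sqE.
Qed.

(** As this holds at every point, it restricts to all slices at once, so that
    the symmetry of the kernels of [D_t] needs no null sets. *)
Lemma symmetrization_perm (R : realType) n (f : Rn R n -> R) s x :
  symmetrization f (perm_coord s x) = symmetrization f x.
Proof.
rewrite /symmetrization [in RHS](reindex_inj (mulIg s)) /=.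
by congr (_ * _); apply: eq_bigr => r _; rewrite perm_coordM.
Qed.

Lemma measurable_symmetrization (R : realType) n (f : Rn R n -> R) :
  measurable_fun setT f -> measurable_fun setT (symmetrization f).
Proof.
move=> mf; apply: measurable_funM => //; apply: measurable_sum => s.
exact: measurableT_comp (measurable_perm_coord s).
Qed.

(** * Membership in G^* *)

Lemma nneseries_term_lty (R : realType) (w : nat -> R) (a : nat -> \bar R) n :
  (forall k, 0 < w k) -> (forall k, 0 <= a k)%E ->
  (\sum_(0 <= k <oo) (w k)%:E * a k < +oo)%E -> (a n < +oo)%E.
Proof.
move=> w0 a0 soo; have wa0 k : (0 <= (w k)%:E * a k)%E.
  by rewrite mule_ge0// lee_fin ltW.
have wan : ((w n)%:E * a n < +oo)%E.
  apply: le_lt_trans soo; apply: le_trans (nneseries_lim_ge n.+1 _) => //.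
  rewrite big_nat_recr//= leeDr//.
  by apply: sume_ge0 => k _; exact: wa0.
case: (a n) wan => [r _|+|//]; first exact: ltry.
by rewrite gt0_muley ?lte_fin.
Qed.

(** Finiteness of the norm of the series, whose weights are positive, already
    gives the square-integrability of each kernel. *)
Lemma in_G_intro (R : realType) (lambda : R) (phi : chaos R) :
  (forall n, measurable_fun setT (phi n)) ->
  (forall n, ae_symmetric (phi n)) ->
  (chaos_norm_sq lambda phi < +oo)%E -> in_G_ lambda phi.
Proof.
move=> mphi sphi phioo; split => // n; split=> //.
apply: Lfun_L2norm_sq => //; apply: nneseries_term_lty phioo => k.
- by rewrite mulr_gt0 ?expR_gt0// ltr0n fact_gt0.
- exact: L2norm_sq_ge0.
Qed.

Lemma in_Gstar_ae_eq (R : realType) (phi psi : chaos R) :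
  (forall n, measurable_fun setT (phi n)) ->
  (forall n, measurable_fun setT (psi n)) ->
  (forall n, {ae lebesgue_Rn n, forall x, phi n x = psi n x}) ->
  in_Gstar phi -> in_Gstar psi.
Proof.
move=> mphi mpsi phi_psi [lambda lambda0 [phiL2 phioo]].
exists lambda => //; apply: in_G_intro => // [n s|].
  have [_ /(_ s) phi_s] := phiL2 n.
  have psi_s := ae_perm_coord s (phi_psi n).
  by apply: filterS3 phi_s psi_s (phi_psi n) => x <- <- <-.
rewrite /chaos_norm_sq in phioo *; congr (_ < _)%E : phioo.
apply: eq_eseriesr => n _; congr (_ * _)%E.
exact: ae_eq_L2norm_sq.
Qed.

Lemma joint_kernel_snoc (R : realType) (Phi : R -> chaos R) n x t :
  joint_kernel Phi n (snoc x t) = Phi t n x.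
Proof. by rewrite /joint_kernel but_last_snoc last_coord_snoc. Qed.

Lemma measurable_joint_kernel_slice (R : realType) (Phi : R -> chaos R) n t :
  measurable_fun setT (joint_kernel Phi n) -> measurable_fun setT (Phi t n).
Proof.
move=> mPhi; rewrite (_ : Phi t n = joint_kernel Phi n \o (fun x => snoc x t)).
  exact: measurableT_comp (measurable_snocl _).
by apply/funext => x /=; rewrite joint_kernel_snoc.
Qed.

Lemma measurable_skorohod (R : realType) (Psi : R -> chaos R) n :
  (forall k, measurable_fun setT (joint_kernel Psi k)) ->
  measurable_fun setT (@skorohod _ Psi n).
Proof.
case: n => [|n] mPsi; first exact: measurable_cst.
exact: measurable_symmetrization.
Qed.

Lemma measurable_stoch_deriv (R : realType) (phi : chaos R) n t :
  measurable_fun setT (phi n.+1) ->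
  measurable_fun setT (@stoch_deriv _ t phi n).
Proof.
move=> mphi; apply: measurable_funM => //.
exact: measurableT_comp (measurable_snocl _).
Qed.

(** The weight of [D_t] at [lambda + 1], times the factor [n.+1 ^+ 2] from the
    definition of [D_t], is
    [n.+1`! * n.+1 * expR (- 2 n) * expR (- 2 lambda n)], and
    [n.+1 <= expR (2 n)]. *)
Lemma stoch_deriv_weight (R : realType) (lambda : R) n :
  n`!%:R * expR (2 * - (lambda + 1) * n%:R) * n.+1%:R ^+ 2 <=
  expR (2 * lambda) * (n.+1`!%:R * expR (- (2 * n.+1%:R * lambda))).
Proof.
rewrite factS natrM.
have -> : expR (2 * lambda) *
      (n.+1%:R * n`!%:R * expR (- (2 * n.+1%:R * lambda)))
    = n.+1%:R * n`!%:R * expR (2 * - lambda * n%:R) :> R.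
  rewrite mulrCA -expRD; congr (_ * expR _); rewrite -natr1; ring.
have -> : 2 * - (lambda + 1) * n%:R = 2 * - lambda * n%:R - 2 * n%:R :> R.
  by ring.
rewrite expRD.
have n_exp : n.+1%:R * expR (- (2 * n%:R)) <= 1 :> R.
  rewrite expRN ler_pdivrMr ?expR_gt0// mul1r.
  apply: le_trans (expR_ge1Dx _).
  by rewrite -natr1 addrC lerD2l mulr_natl mulr2n lerDl.
have -> : n`!%:R * (expR (2 * - lambda * n%:R) * expR (- (2 * n%:R))) *
      n.+1%:R ^+ 2
    = n.+1%:R * n`!%:R * expR (2 * - lambda * n%:R) *
      (n.+1%:R * expR (- (2 * n%:R))) :> R by ring.
by rewrite ler_piMr// !mulr_ge0// expR_ge0.
Qed.

(** A nonnegative function with a finite integral is finite almost everywhere;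
    this is applied to the squared norm of [D_t] of the Skorohod integral at
    [lambda + 1], as a function of [t]. *)
Lemma in_Gstar_stoch_deriv_skorohod (R : realType) (Psi : R -> chaos R) :
  skorohod_integrable Psi ->
  {ae @lebesgue_measure R, forall t, in_Gstar (stoch_deriv t (skorohod Psi))}.
Proof.
move=> [[mPsi _] [lambda lambda0 normoo]].
pose g n := symmetrization (joint_kernel Psi n).
have mg n : measurable_fun setT (g n) by exact: measurable_symmetrization.
pose w n : R := n`!%:R * expR (2 * - (lambda + 1) * n%:R).
have w0 n : 0 <= w n by rewrite mulr_ge0// expR_ge0.
pose N n (t : measurableTypeR R) :=
  ((w n)%:E * L2norm_sq (@stoch_deriv _ t (skorohod Psi) n))%E.
have N0 n t : (0 <= N n t)%E by rewrite mule_ge0// ?lee_fin// L2norm_sq_ge0.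
have NE n t : N n t =
    ((w n * n.+1%:R ^+ 2)%:E * L2norm_sq (fun x => g n (snoc x t)))%E.
  rewrite /N L2norm_sqZ ?EFinM ?muleA//.
  exact: (measurableT_comp (mg n) (measurable_snocl t)).
have mN n : measurable_fun setT (N n).
  rewrite (funext (NE n)); apply: measurable_funeM.
  exact: measurable_L2norm_sq_snoc.
have intN n : (\int[lebesgue_measure]_t N n t =
    (w n * n.+1%:R ^+ 2)%:E * L2norm_sq (g n))%E.
  rewrite L2norm_sq_snoc// -ge0_integralZl//.
  - by apply: eq_integral => t _; exact: NE.
  - exact: measurable_L2norm_sq_snoc.
  - by move=> t _; exact: L2norm_sq_ge0.
  - by rewrite lee_fin mulr_ge0// sqr_ge0.
have sumN : (\int[lebesgue_measure]_t (\sum_(0 <= n <oo) N n t) < +oo)%E.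
  rewrite integral_nneseries//.
  under eq_eseriesr do rewrite intN.
  pose v n : R := (n.+1)`!%:R * expR (- (2 * n.+1%:R * lambda)).
  have v0 n : 0 <= v n by rewrite mulr_ge0// expR_ge0.
  apply: (@le_lt_trans _ _
    (\sum_(0 <= n <oo)
       (expR (2 * lambda))%:E * ((v n)%:E * L2norm_sq (g n)))%E).
    apply: lee_nneseries => [n _ _|n _].
      by rewrite mule_ge0// ?L2norm_sq_ge0// lee_fin mulr_ge0// sqr_ge0.
    rewrite [leRHS]muleA -EFinM lee_wpmul2r ?L2norm_sq_ge0// lee_fin.
    exact: stoch_deriv_weight.
  rewrite nneseriesZl => [|n _]; last first.
    by rewrite mule_ge0// ?L2norm_sq_ge0// lee_fin.
  by rewrite lte_mul_pinfty// lee_fin expR_ge0.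
have sumN0 t : (0 <= \sum_(0 <= n <oo) N n t)%E by exact: nneseries_ge0.
have intsN : lebesgue_measure.-integrable setT
    (fun t : measurableTypeR R => \sum_(0 <= n <oo) N n t)%E.
  apply/integrableP; split; first exact: ge0_emeasurable_sum.
  by under eq_integral do rewrite gee0_abs//.
apply: filterS (integrable_ae measurableT intsN) => t /(_ I) Nfin.
exists (lambda + 1); first by rewrite addr_gt0.
apply: in_G_intro => [n|n s|].
- by apply: measurable_stoch_deriv; exact: measurable_skorohod.
- apply: aeW => x /=; rewrite /stoch_deriv/=.
  by rewrite -perm_coord_snoc symmetrization_perm.
- by move: Nfin; rewrite ge0_fin_numE.
Qed.

(** * The commutation relation *)

Lemma measurable_restrict_process (R : realType) (T : set (measurableTypeR R))
    (Phi : R -> chaos R) n :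
  measurable T -> measurable_fun setT (joint_kernel Phi n) ->
  measurable_fun setT (joint_kernel (restrict_process T Phi) n).
Proof.
move=> mT mPhi; apply: measurable_funM => //.
exact: (measurableT_comp (measurable_indic mT) measurable_last_coord).
Qed.

Lemma restrict_processE (R : realType) (T : set R) (Phi : R -> chaos R) n t x :
  T t -> restrict_process T Phi t x = Phi t n x.
Proof. by move=> Tt; rewrite /restrict_process indicE mem_set// mul1r. Qed.

(** Two permutations that send the last index to the same place differ by a
    permutation of the other indices, under which [f] is symmetric. *)
Lemma ae_perm_coord_fix_max (R : realType) n (f : Rn R n.+1 -> R) :
  measurable_fun setT f ->
  {ae @lebesgue_measure R, forall t, ae_symmetric (fun x => f (snoc x t))} ->
  {ae lebesgue_Rn n.+1, forall y, forall r r' : 'S_n.+1,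
    r ord_max = r' ord_max -> f (perm_coord r y) = f (perm_coord r' y)}.
Proof.
move=> mf sym_f.
pose fix_max (s : 'S_n) : 'S_n.+1 := lift_perm ord_max ord_max s.
have f_fix (s : 'S_n) :
    {ae lebesgue_Rn n.+1, forall y, f (perm_coord (fix_max s) y) = f y}.
  apply: ae_of_snoc.
    have mf_s : measurable_fun setT (fun y => f (perm_coord (fix_max s) y)).
      exact: measurableT_comp (measurable_perm_coord _).
    have := measurable_fun_eqr mf_s mf measurableT (Y := [set true]) Logic.I.
    rewrite setTI; congr measurable; apply/seteqP.
    by split => y /= /eqP.
  apply: filterS sym_f => t /(_ s); apply: filterS => x.
  by rewrite perm_coord_snoc.
have f_fix_all : {ae lebesgue_Rn n.+1, forall y, forall rs : 'S_n.+1 * 'S_n,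
    f (perm_coord (fix_max rs.2 * rs.1)%g y) = f (perm_coord rs.1 y)}.
  apply: filter_forall => -[r s].
  apply: filterS (ae_perm_coord r (f_fix s)) => y /=.
  by rewrite perm_coordM.
apply: filterS f_fix_all => y fy r r' rr'.
have [s rs] : exists s, (r' * r^-1)%g = fix_max s.
  by apply: lift_perm_surj; rewrite permM -rr' permK.
by rewrite -(fy (r, s)) /= -rs mulgKV.
Qed.

Lemma factS_quotient (F : numFieldType) n :
  n.+1%:R * (n.+1`!%:R)^-1 * n`!%:R = 1 :> F.
Proof. by rewrite mulrAC -natrM -factS mulfV// pnatr_eq0 -lt0n fact_gt0. Qed.

Lemma mulr_symmetrization (R : realType) n (f : Rn R n.+1 -> R) y :
  (forall r r' : 'S_n.+1,
    r ord_max = r' ord_max -> f (perm_coord r y) = f (perm_coord r' y)) ->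
  n.+1%:R * symmetrization f y =
  \sum_(j < n.+1) f (perm_coord (tperm j ord_max) y).
Proof.
move=> f_max; rewrite /symmetrization mulrA.
rewrite (eq_bigr (fun r : 'S_n.+1 =>
    f (perm_coord (tperm (r ord_max) ord_max) y))).
  rewrite (sum_perm_at (fun j => f (perm_coord (tperm j ord_max) y))).
  by rewrite mulrA factS_quotient mul1r.
by move=> r _; apply: f_max; rewrite tpermR.
Qed.

(** In the kernel of [D_t (Phi s)], the time [s] of the process comes last and
    [t] is the last argument of the kernel of [Phi s]; as arguments of the joint
    kernel of [Phi] they are exchanged. *)
Lemma perm_coord_tperm_snoc (R : realType) n (x : Rn R n.+1) (t : R) :
  perm_coord (tperm (lift ord_max ord_max) ord_max) (snoc x t) =
  snoc (snoc (but_last x) t) (last_coord x).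
Proof.
apply/esym/eq_snoc => [i|]; rewrite tnth_mktuple.
  case: (unliftP ord_max i) => [j|] ->.
    rewrite tpermD ?(inj_eq (lift_inj (h := _))) ?neq_lift//.
    by rewrite !tnth_snoc tnth_mktuple lift_max_widen.
  by rewrite tpermL !tnth_snoc.
by rewrite tpermR tnth_snoc.
Qed.

(** For [s] in 'S_n, the corresponding term of the symmetrization puts the
    coordinate [x_(s n.-1)] last in the joint kernel of [Phi], so that it only
    depends on the value of [s] at the last index. *)
Lemma skorohod_on_stoch_derivE (R : realType) (T : set R) (Phi : R -> chaos R)
    n (x : Rn R n) t :
  (forall r r' : 'S_n.+1, r ord_max = r' ord_max ->
    joint_kernel (restrict_process T Phi) n (perm_coord r (snoc x t)) =
    joint_kernel (restrict_process T Phi) n (perm_coord r' (snoc x t))) ->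
  skorohod_on T (fun s => stoch_deriv t (Phi s)) x =
  \sum_(j < n) joint_kernel (restrict_process T Phi) n
                 (perm_coord (tperm (lift ord_max j) ord_max) (snoc x t)).
Proof.
case: n x => [|k] x f_max; first by rewrite big_ord0.
set f := joint_kernel _ _ in f_max *.
pose c j := f (perm_coord (tperm j ord_max) (snoc x t)).
rewrite /skorohod_on /= /symmetrization.
rewrite (eq_bigr (fun s : 'S_k.+1 => k.+1%:R * c (lift ord_max (s ord_max)))).
  rewrite -mulr_sumr (sum_perm_at (fun j => c (lift ord_max j))).
  by rewrite !mulrA (mulrC _^-1) factS_quotient mul1r.
move=> s _; rewrite {1}/joint_kernel /restrict_process /stoch_deriv mulrCA.
congr (_ * _).
transitivity (f (perm_coord (tperm (lift ord_max ord_max) ord_max)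
                            (snoc (perm_coord s x) t))).
  by rewrite perm_coord_tperm_snoc /f joint_kernel_snoc.
rewrite -perm_coord_snoc perm_coordM; apply: f_max.
by rewrite permM tpermR lift_perm_lift tpermR.
Qed.

Lemma measurable_joint_kernel_stoch_deriv (R : realType) (Phi : R -> chaos R)
    n t :
  measurable_fun setT (joint_kernel Phi n.+1) ->
  measurable_fun setT (joint_kernel (fun s => stoch_deriv t (Phi s)) n).
Proof.
move=> mPhi; apply: measurable_funM => //.
pose swap : 'S_n.+2 := tperm (lift ord_max ord_max) ord_max.
rewrite (_ : (fun _ => _) =
    joint_kernel Phi n.+1 \o (perm_coord swap \o (fun x => snoc x t))).
  apply: measurableT_comp => //.
  exact: measurableT_comp (measurable_perm_coord _) (measurable_snocl _).
by apply/funext => x /=; rewrite perm_coord_tperm_snoc joint_kernel_snoc.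
Qed.

Lemma stoch_deriv_skorohod_kernel (R : realType) (T : set (measurableTypeR R))
    (Phi : R -> chaos R) n :
  measurable T -> Gstar_process Phi ->
  {ae @lebesgue_measure R, forall t, T t ->
    {ae lebesgue_Rn n, forall x, stoch_deriv t (skorohod_on T Phi) x =
      chaos_add (Phi t) (skorohod_on T (fun s => stoch_deriv t (Phi s))) x}}.
Proof.
move=> mT [mPhi Gstar_Phi'].
(* The type [R] of times is only convertible to the measurable type on which
   Lebesgue measure lives. *)
have Gstar_Phi : {ae @lebesgue_measure R, forall t : measurableTypeR R,
    in_Gstar (Phi t)} := Gstar_Phi'.
have mPhiT : measurable_fun setT (joint_kernel (restrict_process T Phi) n).
  exact: measurable_restrict_process.
have sym_f : {ae @lebesgue_measure R, forall t, ae_symmetric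
    (fun x => joint_kernel (restrict_process T Phi) n (snoc x t))}.
  apply: filterS Gstar_Phi => t [_ _ [PhiL2 _]] s.
  have [_ /(_ s)] := PhiL2 n; apply: filterS => x.
  by rewrite !joint_kernel_snoc /restrict_process => ->.
apply: filterS (ae_snoc (ae_perm_coord_fix_max mPhiT sym_f)) => t.
move=> aet Tt; apply: filterS aet => x f_max.
rewrite /chaos_add skorohod_on_stoch_derivE//.
rewrite /stoch_deriv /skorohod_on /= mulr_symmetrization//.
(* The term where [t] itself is put last is [Phi t]. *)
rewrite big_ord_recr /= addrC.
congr (_ + _).
  by rewrite tperm1 perm_coord1 joint_kernel_snoc restrict_processE.
by apply: eq_bigr => j _; rewrite lift_max_widen.
Qed.

Theorem theorem3p12 (R : realType) (T : set (measurableTypeR R))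
    (Phi : R -> chaos R)
    (mT : measurable T)
    (Phi_process : Gstar_process Phi)
    (Phi_int : skorohod_integrable_on T Phi)
    (DPhi_int : {ae @lebesgue_measure R, forall t, T t ->
       skorohod_integrable_on T (fun s => stoch_deriv t (Phi s))}) :
  {ae @lebesgue_measure R, forall t, T t ->
    eq_Gstar (stoch_deriv t (skorohod_on T Phi))
      (chaos_add (Phi t)
         (skorohod_on T (fun s => stoch_deriv t (Phi s))))}.
Proof.
have [mPhi _] := Phi_process.
have kernel_eq n := stoch_deriv_skorohod_kernel n mT Phi_process.
have := in_Gstar_stoch_deriv_skorohod Phi_int.
have := ae_foralln kernel_eq.
apply: filterS2 => t kernel_eqt Gstar_D Tt.
have eqD n := kernel_eqt n Tt.
split => //; apply: in_Gstar_ae_eq eqD Gstar_D => n.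
  apply: measurable_stoch_deriv; apply: measurable_skorohod => k.
  exact: measurable_restrict_process.
apply: measurable_funD; first exact: measurable_joint_kernel_slice (mPhi n).
apply: measurable_skorohod => k.
apply: measurable_restrict_process => //.
exact: measurable_joint_kernel_stoch_deriv.
Qed.
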